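(* The variety $C_r(\mathcal{N}_n)$ is reducible for all integers $n\ge 4$ and $r\ge 4$.
   Context: $k$ is an algebraically closed field and $\mathcal{N}_n$ is the variety of nilpotent $n\times n$ matrices over $k$, a closed subvariety of the affine space $\mathfrak{gl}_n$ of $n\times n$ matrices. $C_r(\mathcal{N}_n)=\{(v_1,\ldots,v_r)\in(\mathcal{N}_n)^r : [v_i,v_j]=0 \text{ for all } i,j\}$, with the Zariski topology. Reducible means not irreducible as a topological space. *)

(* Defs.v *)
From HB Require Import structures.
From mathcomp Require Import all_boot all_order all_algebra.
From mathcomp Require Import mpoly.
From mathcomp Require Import boolp classical_sets topology_structure.

Set Implicit Arguments.
Unset Strict Implicit.
Unset Printing Implicit Defensive.

Import GRing.Theory.
Local Open Scope classical_set_scope.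
Local Open Scope ring_scope.

(* The affine space gl_n^r, of dimension r * n ^ 2.  It is a separate constant
   so that the Zariski topology declared below is the only topology on it. *)
Definition gl_pow (k : fieldType) (n r : nat) : Type := {ffun 'I_r -> 'M[k]_n}.

HB.instance Definition _ (k : fieldType) (n r : nat) :=
  Choice.copy (gl_pow k n r) {ffun 'I_r -> 'M[k]_n}.

Section Zariski.
Variables (k : fieldType) (n r : nat).

Definition entry : finType := ('I_r * ('I_n * 'I_n))%type.

Definition gl_coord (v : gl_pow k n r) (l : 'I_#|entry|) : k :=
  let e := enum_val l in (v : {ffun _ -> _}) e.1 e.2.1 e.2.2.

Definition zero_locus (S : set {mpoly k[#|entry|]}) : set (gl_pow k n r) :=
  [set v | forall p, S p -> p.@[gl_coord v] = 0].

Definition zariski_open (U : set (gl_pow k n r)) : Prop :=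
  exists S : set {mpoly k[#|entry|]}, ~` U = zero_locus S.

Lemma zariski_openT : zariski_open setT.
Proof.
exists setT; rewrite setCT; apply/seteqP; split=> // v /(_ 1 I).
by rewrite meval1 => /eqP; rewrite oner_eq0.
Qed.

Lemma zariski_openI : setI_closed zariski_open.
Proof.
move=> A B [S SE] [T TE].
exists [set q | exists p1 p2, [/\ S p1, T p2 & q = p1 * p2]].
rewrite setCI SE TE; apply/seteqP; split=> v.
  case=> Zv q [p1] [p2] [Sp Tp ->]; rewrite mevalM.
    by rewrite (Zv p1 Sp) mul0r.
  by rewrite (Zv p2 Tp) mulr0.
move=> Zv; apply: contrapT => /not_orP[/existsNP[p1 /not_implyP[Sp p1v]]].
move=> /existsNP[p2 /not_implyP[Tp p2v]].
have /eqP : (p1 * p2).@[gl_coord v] = 0 by apply: Zv; exists p1, p2.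
by rewrite mevalM mulf_eq0 => /orP[] /eqP.
Qed.

Lemma zariski_open_bigU (I : Type) (f : I -> set (gl_pow k n r)) :
  (forall i, zariski_open (f i)) -> zariski_open (\bigcup_i f i).
Proof.
move=> fo; exists [set p | forall v, (~` \bigcup_i f i) v -> p.@[gl_coord v] = 0].
apply/seteqP; split=> v; first by move=> nv p; apply.
move=> Zv [i _ fiv]; have [S SE] := fo i.
suff : (~` f i) v by apply.
rewrite SE => p Sp; apply: Zv => w nw.
suff : zero_locus S w by apply.
by rewrite -SE => fiw; apply: nw; exists i.
Qed.

HB.instance Definition _ := isOpenTopological.Build (gl_pow k n r)
  zariski_openT zariski_openI zariski_open_bigU.

Lemma zariski_closedE (Z : set (gl_pow k n r)) :
  closed Z <-> exists S, Z = zero_locus S.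
Proof.
have opE (U : set (gl_pow k n r)) : open U = zariski_open U by [].
by rewrite -openC opE /zariski_open setCK.
Qed.

End Zariski.

(* Irreducibility of A for the subspace topology: the closed subsets of A are
   the sets F `&` A with F closed in T, and F `&` A is all of A iff A `<=` F. *)
Definition irreducible (T : topologicalType) (A : set T) : Prop :=
  A !=set0 /\
  forall F G : set T, closed F -> closed G ->
    A `<=` F `|` G -> A `<=` F \/ A `<=` G.

Definition reducible (T : topologicalType) (A : set T) : Prop :=
  ~ irreducible A.

Definition nilpotent_mx (k : fieldType) (n : nat) : set 'M[k]_n :=
  [set A | exists m : nat, A ^+ m = 0].

Definition comm_nilp (k : fieldType) (n r : nat) : set (gl_pow k n r) :=
  [set v : {ffun 'I_r -> 'M[k]_n} |
    (forall i, nilpotent_mx (v i)) /\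
    (forall i j, v i *m v j - v j *m v i = 0)].
Arguments comm_nilp : clear implicits.

(* Main.v *)
Require Import Defs.
From mathcomp Require Import all_boot all_order all_algebra.
From mathcomp Require Import mpoly zify.
From mathcomp Require Import boolp classical_sets topology_structure.

(* If v_0^(n-1) <> 0 for a tuple v of commuting nilpotent matrices, then v_0 has
   a cyclic vector u, so a matrix commuting with v_0 is determined by its value
   at u; hence the n + 1 matrices 1, v_0, ..., v_0^(n-3), v_1, v_2, v_3 are
   linearly dependent.  So C_r(N_n) is covered by two closed sets: one entry of
   v_0^(n-1) vanishes, or one maximal minor of the coordinates of these n + 1
   matrices vanishes.  Neither set suffices: take v_0 a full Jordan block for
   the first, and for the second, with basis e_1, ..., e_(n-2), f_1, f_2,
     v_0 : e_1 -> e_2 -> ... -> e_(n-2) -> 0,  v_1 : e_1 -> f_2,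
     v_2 : f_1 -> f_2,  v_3 : f_1 -> e_(n-2),
   where any product of two distinct matrices vanishes. *)

Set Implicit Arguments.
Unset Strict Implicit.
Unset Printing Implicit Defensive.

Import GRing.Theory.
Local Open Scope classical_set_scope.
Local Open Scope ring_scope.

(** Vectors are rows. The vectors u, uA, ..., uA^n form a basis, and B kills each of them because it
    commutes with A. *)
Lemma comm_mx_cyclic_eq0 (k : fieldType) (n : nat) (A B : 'M[k]_n.+1)
    (u : 'rV[k]_n.+1) :
  nilpotent_mx A -> u *m A ^+ n != 0 -> comm_mx A B -> u *m B = 0 -> B = 0.
Proof.
move=> [m Am] un0 cAB uB0.
have nilu : exists s, u *m A ^+ s == 0 by exists m; rewrite Am mulmx0.
pose C : 'M[k]_n.+1 := \matrix_(i < n.+1) (u *m A ^+ i).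
have CB0 : C *m B = 0.
  apply/row_matrixP => i; rewrite row_mul rowK row0 -mulmxA.
  have -> : A ^+ i *m B = B *m A ^+ i by exact: esym (commrX i (esym cAB)).
  by rewrite mulmxA uB0 mul0mx.
suff Cunit : C \in unitmx by rewrite -[B](mulKmx Cunit) CB0 mulmx0.
rewrite -row_free_unit; apply/inj_row_free => w wC0.
apply/eqP/contraT => /rV0Pn [i0 wi0].
case: (arg_minnP (P := fun i => w 0 i != 0) val wi0) => i wi imin.
(* Here [i] is the first index with a nonzero coefficient. Multiplying the relation by A^t leaves
   only its [i]-th term. The least [s'] with uA^s' = 0 exceeds [n], hence [i], so t = s' - 1 - i
   works. *)
have [t [ut0 utN]] : exists t, u *m A ^+ (i + t) != 0 /\ u *m A ^+ (i + t).+1 = 0.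
  case: (ex_minnP nilu) => s' /eqP us0 smin.
  have lt_ns : (n < s')%N.
    rewrite ltnNge; apply: contra un0 => le_sn.
    have -> : A ^+ n = A ^+ s' *m A ^+ (n - s') by rewrite mulmxE -exprD subnKC.
    by rewrite mulmxA us0 mul0mx.
  have lei : (i <= s'.-1)%N by have := ltn_ord i; lia.
  exists (s'.-1 - i)%N; rewrite subnKC // prednK ?us0; last by lia.
  by split=> //; apply/negP => /smin; lia.
have : w *m C *m A ^+ t = 0 by rewrite wC0 mul0mx.
rewrite [w *m C]mulmx_sum_row mulmx_suml (bigD1 i) //= big1 ?addr0 => [|j ji].
  rewrite rowK -scalemxAl -mulmxA mulmxE -exprD.
  by move/eqP; rewrite scaler_eq0 (negPf wi) (negPf ut0).
have [->|wj] := eqVneq (w 0 j) 0; first by rewrite scale0r mul0mx.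
have ltij : (i < j)%N by rewrite ltn_neqAle imin // andbT eq_sym.
rewrite rowK -scalemxAl -mulmxA mulmxE -exprD.
have -> : (j + t = (i + t).+1 + (j - i.+1))%N by lia.
by rewrite exprD mulmxA utN mul0mx scaler0.
Qed.

(** The n + 2 vectors u W_i live in dimension n + 1. A relation among them gives a combination of
    the W_i that commutes with A and kills u. *)
Lemma comm_mx_cyclic_dep (k : fieldType) (n : nat) (A : 'M[k]_n.+1)
    (u : 'rV[k]_n.+1) (W : 'I_n.+2 -> 'M[k]_n.+1) :
  nilpotent_mx A -> u *m A ^+ n != 0 -> (forall i, comm_mx A (W i)) ->
  exists2 w : 'rV[k]_n.+2, w != 0 & \sum_i w 0 i *: W i = 0.
Proof.
move=> nilA un0 cAW; pose C : 'M[k]_(n.+2, n.+1) := \matrix_i (u *m W i).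
have /rowV0Pn [w /sub_kermxP wC0 w0] : kermx C != 0.
  by rewrite kermx_eq0 /row_free neq_ltn ltnS rank_leq_col.
exists w => //; apply: (comm_mx_cyclic_eq0 nilA un0).
  by apply: comm_mx_sum => i _; rewrite /comm_mx -scalemxAr -scalemxAl cAW.
rewrite -[RHS]wC0 mulmx_sumr [RHS]mulmx_sum_row.
by apply: eq_bigr => i _; rewrite rowK scalemxAr.
Qed.

(* From here on the matrix size, called n in the header, is n.+4. *)
Section Words.
Variable n : nat.

(** For i up to n + 4 these are the matrices of the header; the offset makes index n + 2 yield
    [A 1]. *)
Definition word (R : nzRingType) (A : nat -> 'M[R]_n.+4) (i : nat) :=
  if (i < n.+2)%N then A 0%N ^+ i else A (i - n.+1)%N.

(* Position (wrow j, wcol j) is where the j-th matrix of the header's second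
   example has a 1 and the other ones a 0. *)
Definition wrow (j : nat) : 'I_n.+4 := inord (if (j < n.+3)%N then 0 else n.+2).

Definition wcol (j : nat) : 'I_n.+4 :=
  inord (if (j < n.+2)%N then j else if (j < n.+4)%N then n.+3 else n.+1).

Lemma wrowE l : wrow l = (if (l < n.+3)%N then 0 else n.+2)%N :> nat.
Proof. by rewrite inordK //; case: ifP. Qed.

Lemma wcolE l : (l < n.+4.+1)%N ->
  wcol l = (if (l < n.+2)%N then l
            else if (l < n.+4)%N then n.+3 else n.+1)%N :> nat.
Proof. by move=> lt_l; rewrite inordK //; repeat case: ifP; lia. Qed.

Definition word_minor (R : nzRingType) (A : nat -> 'M[R]_n.+4) : 'M[R]_n.+4.+1 :=
  \matrix_(i, j) word A i (wrow j) (wcol j).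

Lemma map_word_minor (R S : nzRingType) (f : {rmorphism R -> S}) A :
  map_mx f (word_minor A) = word_minor (fun i => map_mx f (A i)).
Proof.
apply/matrixP => i j; rewrite !mxE /word.
by case: ifP => _; rewrite -?rmorphXn mxE.
Qed.

(** The first basis vector is cyclic because of the corner entry. A linear relation among the words
    holds at every position, so it is a left kernel vector of the minor. *)
Lemma det_word_minor_eq0 (k : fieldType) (A : nat -> 'M[k]_n.+4) :
  nilpotent_mx (A 0%N) -> (forall i, comm_mx (A 0%N) (A i)) ->
  (A 0%N ^+ n.+3) 0 ord_max != 0 -> \det (word_minor A) = 0.
Proof.
move=> nilA cA A0; have [||w w0 wW] := @comm_mx_cyclic_dep _ _ (A 0%N)
    (delta_mx 0 0) (fun i => word A i) nilA.
- by rewrite -rowE; apply/rV0Pn; exists ord_max; rewrite mxE.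
- move=> i; rewrite /word; case: ifP => _ //.
  exact: (@commrX _ (A 0%N) (A 0%N)).
apply/eqP/det0P; exists w => //; apply/rowP => j; rewrite !mxE.
have /matrixP/(_ (wrow j) (wcol j)) := wW; rewrite summxE mxE => wW0.
by rewrite -[RHS]wW0; apply: eq_bigr => i _; rewrite !mxE.
Qed.

(* Row vectors: e_i *m shift_mx s = e_(i+1) if i + 1 < s, and 0 otherwise. *)
Definition shift_mx (R : nzRingType) (s : nat) : 'M[R]_n.+4 :=
  \matrix_(i, j) ((j == i.+1 :> nat) && (j < s)%N)%:R.

Lemma shift_mxX (R : nzRingType) s m i j :
  (shift_mx R s ^+ m.+1) i j = ((j == i + m.+1 :> nat)%N && (j < s)%N)%:R.
Proof.
elim: m i => [|m IHm] i; first by rewrite expr1 mxE addn1.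
rewrite exprS -mulmxE mxE.
have [lt_i|ge_i] := ltnP i.+1 n.+4.
  rewrite (bigD1 (Ordinal lt_i)) //= big1 ?addr0 => [|l li].
    by rewrite IHm mxE /= eqxx -natrM mulnb; congr (_%:R); lia.
  by rewrite mxE; move: li; rewrite -val_eqE /= => /negPf ->; rewrite mul0r.
rewrite big1 => [|l _].
  by have := ltn_ord j; case: eqP => //=; lia.
by rewrite mxE; have := ltn_ord l; case: eqP; rewrite ?mul0r //=; lia.
Qed.

Lemma shift_mx_nilpotent (k : fieldType) s : nilpotent_mx (shift_mx k s).
Proof.
exists n.+4; apply/matrixP => i j; rewrite shift_mxX mxE.
by have := ltn_ord j; case: eqP => //=; lia.
Qed.

(** Counting from 0, f_1 and f_2 are the basis vectors n + 2 and n + 3. Zero matrices fill tuples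
    longer than 4. *)
Definition word_family (R : nzRingType) (i : nat) : 'M[R]_n.+4 :=
  if i is 0 then shift_mx R n.+2
  else if (i < 4)%N then delta_mx (wrow (i + n.+1)) (wcol (i + n.+1)) else 0.

(** Matrices 1, 2, 3 are nonzero only on e_1 and f_1, which no image involves; their own images lie
    in the span of f_2 and e_(n-2), which matrix 0 kills. *)
Lemma word_family_mul0 (R : nzRingType) i j :
  (0 < i + j)%N -> word_family R i *m word_family R j = 0.
Proof.
have rowE' l : (l.+1 < 4)%N ->
    wrow (l.+1 + n.+1) = (if l is 0 then 0 else n.+2)%N :> nat.
  by rewrite wrowE; case: l => [|l]; case: ifP; lia.
have colE' l : (l.+1 < 4)%N ->
    wcol (l.+1 + n.+1) = (if (l < 2)%N then n.+3 else n.+1)%N :> nat.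
  by move=> l4; rewrite wcolE; repeat case: ifP; lia.
rewrite /word_family; case: i j => [|i] [|j] //= _; repeat case: ifP;
  rewrite ?mulmx0 ?mul0mx // => l1.
- apply/matrixP => a b; rewrite !mxE big1 // => c _; rewrite !mxE.
  have [->|] := eqVneq c; rewrite ?mulr0 //= rowE'; last by lia.
  by case: j l1 => [|j] _; rewrite ?ltnn ?andbF ?mul0r.
- apply/matrixP => a b; rewrite !mxE big1 // => c _; rewrite !mxE.
  have [->|] := eqVneq c; last by rewrite andbF mul0r.
  suff -> : (b == (wcol (i.+1 + n.+1)).+1 :> nat) && (b < n.+2)%N = false.
    by rewrite mulr0.
  by rewrite colE'; try case: ifP; lia.
- move=> l2; rewrite mul_delta_mx_cond -val_eqE /= rowE' ?colE'; try lia.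
  by case: ifP; case: (j) => *; case: eqP => //; lia.
Qed.

Lemma word_family_nilpotent (k : fieldType) i : nilpotent_mx (word_family k i).
Proof.
case: i => [|i]; first exact: shift_mx_nilpotent.
by exists 2; rewrite expr2 -mulmxE word_family_mul0.
Qed.

Lemma word_minor_family (R : nzRingType) : word_minor (word_family R) = 1%:M.
Proof.
apply/matrixP => i j; rewrite !mxE /word.
have [lt_i lt_j] := (ltn_ord i, ltn_ord j).
have [|ge_i] := ltnP i n.+2.
  rewrite /=; case iE: (nat_of_ord i) => [|m] lt_m.
    rewrite expr0 mxE -[wrow j == _]val_eqE -[i == j]val_eqE /= wrowE.
    by rewrite wcolE // iE; congr (_%:R); repeat case: ifP; lia.
  rewrite shift_mxX wrowE wcolE // -[i == j]val_eqE /= iE; congr (_%:R).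
  by repeat case: ifP; lia.
have -> : word_family R (i - n.+1) = delta_mx (wrow i) (wcol i).
  case iE: (i - n.+1)%N => [|l] /=; first by lia.
  by rewrite ifT -?iE ?subnK //; lia.
rewrite mxE -[wrow j == _]val_eqE -[wcol j == _]val_eqE -[i == j]val_eqE /=.
by rewrite !wrowE !wcolE //; congr (_%:R); repeat case: ifP; lia.
Qed.

End Words.

Theorem theorem3p4p1 (k : closedFieldType) (n r : nat)
  (hn : (4 <= n)%N) (hr : (4 <= r)%N) :
  reducible (comm_nilp k n r).
Proof.
case: n hn => [|[|[|[|n]]]] // _; case: r hr => [|r] // hr.
pose ev (v : gl_pow k n.+4 r.+1) (i : nat) : 'M[k]_n.+4 :=
  (v : {ffun _ -> _}) (inord i).
(* Generic matrices, whose entries are the coordinate functions: they turn both conditions into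
   polynomial equations. *)
pose X (i : nat) : 'M[{mpoly k[#|entry n.+4 r.+1|]}]_n.+4 :=
  \matrix_(a, b) 'X_(enum_rank (inord i, (a, b))).
have evX v i : map_mx (meval (gl_coord v)) (X i) = ev v i.
  by apply/matrixP => a b; rewrite !mxE mevalXU /gl_coord enum_rankK.
pose locus p : set (gl_pow k n.+4 r.+1) := zero_locus [set p].
have locus_closed p : closed (locus p).
  by apply/zariski_closedE; exists [set p].
have locusE p v : locus p v <-> p.@[gl_coord v] = 0.
  by split=> [|p0 _ ->//]; apply.
pose p := (X 0%N ^+ n.+3) 0 ord_max.
pose q := \det (word_minor X).
have pE v : p.@[gl_coord v] = (ev v 0%N ^+ n.+3) 0 ord_max.
  by rewrite -evX -rmorphXn mxE.
have qE v : q.@[gl_coord v] = \det (word_minor (ev v)).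
  rewrite -det_map_mx map_word_minor; congr (\det (word_minor _)).
  by apply/funext => i; exact: evX.
have subpq : comm_nilp k n.+4 r.+1 `<=` locus p `|` locus q.
  move=> v [nilv cv]; have [pv0|pv0] := eqVneq p.@[gl_coord v] 0.
    by left; apply/locusE.
  right; apply/locusE; rewrite qE det_word_minor_eq0 -?pE //.
    exact: nilv.
  by move=> i; apply/subr0_eq/cv.
case=> _ /(_ _ _ (locus_closed p) (locus_closed q) subpq) [] sub.
(* At this point the corner entry [p] takes the value 1. *)
- pose v : gl_pow k n.+4 r.+1 :=
    [ffun i : 'I_r.+1 => if i == 0 then shift_mx n k n.+4 else 0].
  have /sub/locusE : comm_nilp k n.+4 r.+1 v.
    split=> [i|i j]; rewrite !ffunE.
      by case: ifP => _; [exact: shift_mx_nilpotent|exists 1%N].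
    by do 2!case: ifP => _; rewrite ?mul0mx ?mulmx0 subrr.
  rewrite pE /ev ffunE -val_eqE /= inordK // eqxx shift_mxX /= ltnS leqnn eqxx.
  by move/eqP; rewrite oner_eq0.
- pose v : gl_pow k n.+4 r.+1 := [ffun i : 'I_r.+1 => word_family n k i].
  have /sub/locusE : comm_nilp k n.+4 r.+1 v.
    split=> [i|i j]; rewrite !ffunE; first exact: word_family_nilpotent.
    have [/eqP|ij] := posnP (i + j)%N; last first.
      by rewrite !word_family_mul0 ?subrr // addnC.
    by rewrite addn_eq0 => /andP[/eqP -> /eqP ->]; rewrite subrr.
  (* [inord] falls back to 0 out of range, but [word] reads only the indices 0 to 3, all valid since
     the tuple has at least 4 entries. *)
  rewrite qE; have -> : word_minor (ev v) = word_minor (word_family n k).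
    apply/matrixP => i j; rewrite !mxE /word /ev !ffunE.
    have := ltn_ord i; case: ifP => _ lt_i; rewrite inordK //; lia.
  by rewrite word_minor_family det1 => /eqP; rewrite oner_eq0.
Qed.
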